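(* Let $C\subset\mathbb{R}^n$ be a closed convex set, let $F:\mathbb{R}^n\to\mathbb{R}^n$ be a continuous and monotone plus map, and let $f:\mathbb{R}^n\to\mathbb{R}$ be a coercive convex function. Assume that $f$ is bounded below and that the solution set $S_0$ of the variational inequality $\mathrm{VI}(F,C)$ is nonempty. Then the set $S_1:=\arg\min_{S_0} f$ is nonempty and bounded. Furthermore, let $\{\varepsilon_k\}_{k\ge 0}$ be a non-increasing sequence of non-negative reals with $\varepsilon_0>0$, $\lim_{k\to\infty}\varepsilon_k=0$ and $\sum_{k=0}^\infty\varepsilon_k=+\infty$; let $\{\lambda_k\}_{k\ge 0}$ be a sequence for which there exist $\underline{\lambda}>0$ and $\overline{\lambda}>0$ with $\underline{\lambda}\le\lambda_k\le\overline{\lambda}$ for all $k$; and let $\{\eta_k\}_{k\ge 0}$ be a nonnegative sequence with $\sum_{k=0}^\infty\eta_k<+\infty$. Let $\{x_k\}_{k\ge 0}$ be any sequence generated by the algorithm, i.e. $x_0\in C$ and for every $k\ge 0$ the point $x_{k+1}\in C$ satisfies $$-\frac{x_{k+1}-x_k}{\lambda_k}\in F(x_{k+1})+\varepsilon_k\,\partial_{\eta_k^1}f(x_{k+1})+N_C^{\eta_k^2}(x_{k+1})$$ for some $\eta_k^1,\eta_k^2\ge 0$ with $\eta_k^1+\eta_k^2\le\eta_k$. Then $$\lim_{k\to\infty}d(x_k,S_1)=0.$$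
   Context: The variational inequality $\mathrm{VI}(F,C)$ asks for $x\in C$ with $\langle F(x),y-x\rangle\ge 0$ for all $y\in C$; its solution set is the set of all such $x$. A map $F:\mathbb{R}^n\to\mathbb{R}^n$ is monotone if $\langle F(y)-F(x),y-x\rangle\ge 0$ for all $x,y\in\mathbb{R}^n$; it is monotone plus if it is monotone and, for all $x,y\in\mathbb{R}^n$, $\langle F(x)-F(y),x-y\rangle=0$ implies $F(x)=F(y)$. A function $f$ is coercive if $f(x)\to+\infty$ as $\|x\|\to\infty$. For a convex function $h:\mathbb{R}^n\to\mathbb{R}$, $x\in\mathbb{R}^n$ and $\eta\ge 0$, the $\eta$-subdifferential is $\partial_\eta h(x)=\{v\in\mathbb{R}^n: h(y)\ge h(x)+\langle v,y-x\rangle-\eta\ \ \forall y\in\mathbb{R}^n\}$ (for $\eta=0$ this is the usual subdifferential). For a convex set $C$, $\bar x\in C$ and $\eta\ge 0$, the $\eta$-normal set is $N_C^\eta(\bar x)=\{v\in\mathbb{R}^n:\langle v,x-\bar x\rangle\le\eta\ \ \forall x\in C\}$. Sums of sets are Minkowski sums. For a set $A$, $\arg\min_A h$ denotes the set of minimizers of $h$ over $A$, and $d(x,A)=\inf_{y\in A}\|y-x\|$ (Euclidean norm). *)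

(* Defs.v *)
From mathcomp Require Import all_boot all_order all_algebra.
From mathcomp Require Import all_classical all_reals all_analysis.

Set Implicit Arguments.
Unset Strict Implicit.
Unset Printing Implicit Defensive.

Import Order.TTheory GRing.Theory Num.Theory.
Import numFieldNormedType.Exports.

Local Open Scope classical_set_scope.
Local Open Scope ring_scope.

Section VariationalInequalities.
Context {R : realType} {n : nat}.
Implicit Types (x y u v : 'rV[R]_n) (A B C : set 'rV[R]_n).
Implicit Types (F : 'rV[R]_n -> 'rV[R]_n) (f h : 'rV[R]_n -> R).

Definition dot u v : R := \sum_i u 0 i * v 0 i.

(* The norm [`|x|] of the library is the sup norm; its topology is the one
   used by [continuous] and [closed], and coincides with the Euclidean one. *)
Definition enorm x : R := Num.sqrt (dot x x).

(* [inf] is real-valued, hence equal to 0 by convention when A is empty. *)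
Definition dist x A : R := inf [set enorm (y - x) | y in A].

Definition coercive f :=
  forall M : R, exists r : R, forall x, r <= enorm x -> M <= f x.

Definition monotone_map F := forall x y, 0 <= dot (F y - F x) (y - x).

Definition monotone_plus F :=
  monotone_map F /\
  forall x y, dot (F x - F y) (x - y) = 0 -> F x = F y.

Definition VI_sol F C : set 'rV[R]_n :=
  [set x | C x /\ forall y, C y -> 0 <= dot (F x) (y - x)].

Definition argmin A h : set 'rV[R]_n :=
  [set x | A x /\ forall y, A y -> h x <= h y].

Definition subdiff (eta : R) h x : set 'rV[R]_n :=
  [set v | forall y, h x + dot v (y - x) - eta <= h y].

Definition normal_set (eta : R) C x : set 'rV[R]_n :=
  [set v | forall y, C y -> dot v (y - x) <= eta].

Definition Minkowski_sum A B : set 'rV[R]_n := [set a + b | a in A & b in B].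

Definition scale_set (c : R) A : set 'rV[R]_n := [set c *: a | a in A].

Definition generated F C f (eps lambda eta : nat -> R)
    (x : nat -> 'rV[R]_n) :=
  C (x 0%N) /\
  forall k, C (x k.+1) /\
    exists eta1 eta2 : R,
      [/\ 0 <= eta1, 0 <= eta2, eta1 + eta2 <= eta k &
        Minkowski_sum
          (Minkowski_sum [set F (x k.+1)]
             (scale_set (eps k) (subdiff eta1 f (x k.+1))))
          (normal_set eta2 C (x k.+1))
          (- ((lambda k)^-1 *: (x k.+1 - x k)))].

End VariationalInequalities.

(* Main.v *)
(* The step inclusion gives, for every z in C,
     |x_{k+1} - z|^2 <= |x_k - z|^2 - 2 lambda_k <F(x_{k+1}), x_{k+1} - z>
                        + 2 lambda_k eps_k (f z - f(x_{k+1})) + r_k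
   with r summable.  For z in S1 it shows that the sequence is bounded: either
   f(x_{k+1}) >= f z and the distance to z grows by at most r_k, or x_{k+1}
   lies in a bounded sublevel set of f.

   If z is the projection of x_k on S0, then as long as d(x_{k+1}, S0) stays
   away from 0 the gap <F(x_{k+1}), x_{k+1} - z> is bounded below by
   compactness (it vanishes only on S0 as F is monotone plus) and dominates the
   term in eps_k; hence d(x_k, S0) -> 0.  If z is the projection of x_k on S1,
   then when d(x_{k+1}, S1) stays away from 0, compactness and
   d(x_k, S0) -> 0 force f(x_{k+1}) - min_{S0} f >= c > 0, so the squared
   distance decreases by 2 lambda_k eps_k c up to r_k, and sum eps_k = +oo
   yields d(x_k, S1) -> 0. *)
Require Import Defs.
From mathcomp Require Import all_boot all_order all_algebra.
From mathcomp Require Import all_classical all_reals all_analysis.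
From mathcomp Require Import lra.

Import Order.TTheory GRing.Theory Num.Theory.
Import numFieldNormedType.Exports.

Local Open Scope classical_set_scope.
Local Open Scope ring_scope.

(** * Real series and a perturbed descent principle *)

Lemma seriesS {R : realType} (u : nat -> R) k : series u k.+1 = series u k + u k.
Proof. by rewrite !seriesEnat/= big_nat_recr. Qed.

Lemma nondecreasing_series_ge0 {R : realType} (u : nat -> R) :
  (forall k, 0 <= u k) -> nondecreasing_seq (series u).
Proof. by move=> u0; apply/nondecreasing_seqP => k; rewrite seriesS lerDl. Qed.

(** Divergence of [series a] forces [E] below [d] at some late index. From there the bound [2 * d]
    persists: each step either ends below [d], with a remaining perturbation below [d], or does not
    increase the Lyapunov function. *)
Lemma eventually_lt_of_descent {R : realType} (E a r : nat -> R) (d : R) :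
  0 < d -> (forall k, 0 <= E k) -> (forall k, 0 <= a k) ->
  (forall k, 0 <= r k) -> cvgn (series r) ->
  (forall M, exists N, M <= series a N) ->
  (\forall k \near \oo, d <= E k.+1 -> E k.+1 <= E k - a k + r k) ->
  \forall k \near \oo, E k < 2 * d.
Proof.
move=> d0 E0 a0 r0 cr diva stepE.
(* adding the remaining perturbation turns E into a Lyapunov function *)
pose V k := E k + (limn (series r) - series r k).
have ndr := nondecreasing_series_ge0 _ r0.
have tail0 k : 0 <= limn (series r) - series r k.
  by rewrite subr_ge0; exact: nondecreasing_cvgn_le.
have [K _ KP] : \forall k \near \oo, limn (series r) - series r k < d /\
    (d <= E k.+1 -> V k.+1 <= V k - a k).
  near=> k; split.
    have -> : limn (series r) - series r k = `|limn (series r) - series r k|.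
      by rewrite ger0_norm.
    near: k; have /cvgrPdist_lt := cr; exact.
  move=> dE; have : E k.+1 <= E k - a k + r k by move: dE; near: k.
  rewrite /V seriesS; lra.
have [k0 Kk0 hit] : exists2 k, (K <= k)%N & E k.+1 < d.
  apply: contrapT => /forall2NP nohit.
  have dec j : V (K + j)%N <= V K - (series a (K + j)%N - series a K).
    elim: j => [|j IH]; first by rewrite addn0; lra.
    have [_] := KP (K + j)%N (leq_addr _ _).
    have [//|/negP] := nohit (K + j)%N; first by rewrite leq_addr.
    rewrite -leNgt addnS => /[swap] /[apply].
    by rewrite seriesS; move: IH; lra.
  (* With this [N], [dec] would give [V (K + N) <= -1], although [V] is non-negative. *)
  have [N] := diva (V K + series a K + 1).
  have /(nondecreasing_series_ge0 _ a0) := leq_addl K N.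
  have := dec N; have := tail0 (K + N)%N; have := E0 (K + N)%N; rewrite /V; lra.
exists k0.+1 => //= k.
suff H j : V (k0.+1 + j)%N < 2 * d.
  move=> /subnKC <-; have := H (k - k0.+1)%N.
  by have := tail0 (k0.+1 + (k - k0.+1))%N; rewrite /V; lra.
have KP' i : limn (series r) - series r (k0.+1 + i)%N < d.
  by have [] := KP (k0.+1 + i)%N => //=; rewrite (leq_trans Kk0)// addSnnS leq_addr.
elim: j => [|j IH]; first by have := KP' 0%N; rewrite addn0 /V; lra.
rewrite addnS; have [Ed|Ed] := ltP (E (k0.+1 + j).+1) d.
  by have := KP' j.+1; rewrite addnS /V; lra.
have Kj : (K <= k0.+1 + j)%N by rewrite (leq_trans Kk0)// addSnnS leq_addr.
by have [_ /(_ Ed)] := KP _ Kj; have := a0 (k0.+1 + j)%N; move: IH; lra.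
Unshelve. all: by end_near. Qed.

(** The extended-real sum bounds the monotone real partial sums. *)
Lemma cvgn_series_of_nneseries {R : realType} (u : nat -> R) :
  (forall k, 0 <= u k) -> (\sum_(0 <= k <oo) (u k)%:E < +oo)%E ->
  cvgn (series u).
Proof.
move=> u0 ub; apply: nondecreasing_is_cvgn.
  exact: nondecreasing_series_ge0.
exists (fine (\sum_(0 <= k <oo) (u k)%:E)%E) => _ [N _ <-].
rewrite -lee_fin fineK.
  rewrite seriesEnat/= -sumEFin; apply: nneseries_lim_ge => n _ _.
  by rewrite lee_fin.
by rewrite ge0_fin_numE//; apply: nneseries_ge0 => n _ _; rewrite lee_fin.
Qed.

Lemma series_unbounded_of_nneseries {R : realType} (u : nat -> R) :
  (forall k, 0 <= u k) -> (\sum_(0 <= k <oo) (u k)%:E = +oo)%E ->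
  forall M, exists N, M <= series u N.
Proof.
move=> u0 uoo M.
have : (\sum_(0 <= k < n) (u k)%:E)%E @[n --> \oo] --> +oo%E.
  by rewrite -uoo; apply: is_cvg_nneseries => n _ _; rewrite lee_fin.
move/cvgeyPge => /(_ M)[N _ /(_ N (leqnn N))].
by rewrite sumEFin lee_fin => MN; exists N; rewrite seriesEnat.
Qed.

(** * Euclidean inner product and squared distance *)

Section Dot.
Set Implicit Arguments.
Unset Strict Implicit.
Context {R : realType} {n : nat}.
Implicit Types (x y z u v w : 'rV[R]_n) (A : set 'rV[R]_n).

Lemma dotC u v : dot u v = dot v u.
Proof. by apply: eq_bigr => i _; rewrite mulrC. Qed.

Lemma dotDl u v w : dot (u + v) w = dot u w + dot v w.
Proof. by rewrite -big_split; apply: eq_bigr => i _; rewrite mxE mulrDl. Qed.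

Lemma dotZl (c : R) u v : dot (c *: u) v = c * dot u v.
Proof. by rewrite mulr_sumr; apply: eq_bigr => i _; rewrite mxE mulrA. Qed.

Lemma dotNl u v : dot (- u) v = - dot u v.
Proof. by rewrite -scaleN1r dotZl mulN1r. Qed.

Lemma dotDr u v w : dot w (u + v) = dot w u + dot w v.
Proof. by rewrite !(dotC w) dotDl. Qed.

Lemma dotNr u v : dot u (- v) = - dot u v.
Proof. by rewrite !(dotC u) dotNl. Qed.

Lemma dot_ge0 u : 0 <= dot u u.
Proof. by apply: sumr_ge0 => i _; exact: sqr_ge0. Qed.

Lemma dot_eq0 u : dot u u = 0 -> u = 0.
Proof.
move/eqP; rewrite psumr_eq0 => [/allP u0|i _]; last exact: sqr_ge0.
apply/rowP => i; rewrite mxE; apply/eqP.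
by have := u0 i (mem_index_enum i); rewrite mulf_eq0 orbb.
Qed.

(** Squared distances keep the descent estimates polynomial, within reach of [lra]. *)
Definition sqdist x y : R := dot (x - y) (x - y).

Lemma sqdist_ge0 x y : 0 <= sqdist x y.
Proof. exact: dot_ge0. Qed.

Lemma sqdistxx x : sqdist x x = 0.
Proof. by rewrite /sqdist subrr /dot big1 // => i _; rewrite mxE mul0r. Qed.

Lemma sqdistx0 x : sqdist x 0 = dot x x.
Proof. by rewrite /sqdist subr0. Qed.

Lemma sqdistC x y : sqdist x y = sqdist y x.
Proof. by rewrite /sqdist -(opprB y x) dotNl dotNr opprK. Qed.

(** Parallelogram law for [x - y] and [y - z], with the square of their difference dropped. *)
Lemma sqdist_triangle x y z : sqdist x z <= 2 * sqdist x y + 2 * sqdist y z.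
Proof.
have := dot_ge0 ((x - y) - (y - z)).
have -> : sqdist x z = dot ((x - y) + (y - z)) ((x - y) + (y - z)).
  by rewrite addrA subrK.
rewrite /sqdist; move: (x - y) (y - z) => p q.
rewrite !(dotDl, dotDr, dotNl, dotNr) (dotC q p); lra.
Qed.

Lemma sqdist_three_points x y z :
  2 * dot (y - x) (z - y) = sqdist x z - sqdist y z - sqdist y x.
Proof.
have -> : sqdist x z = dot ((y - x) + (z - y)) ((y - x) + (z - y)).
  by rewrite sqdistC /sqdist [_ - x + _]addrC addrA subrK.
rewrite (sqdistC y z) /sqdist; move: (y - x) (z - y) => p q.
rewrite !(dotDl, dotDr) (dotC q p); lra.
Qed.

Lemma continuous_dot (T : topologicalType) (f g : T -> 'rV[R]_n) :
  continuous f -> continuous g -> continuous (fun t => dot (f t) (g t)).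
Proof.
have cc (h : T -> 'rV[R]_n) i : continuous h -> continuous (fun t => h t 0 i).
  by move=> ch t; apply: (@continuous_comp _ _ _ h (fun M : 'rV[R]_n => M 0 i));
     [exact: ch|exact: coord_continuous].
move=> cf cg; apply: continuous_big => [|i _ t]; first exact: add_continuous.
by apply: cvgM; exact: cc.
Qed.

Lemma sqr_coord_le_dot u i : u 0 i ^+ 2 <= dot u u.
Proof.
rewrite /dot (bigD1 i)//= -expr2 lerDl.
by apply: sumr_ge0 => j _; exact: sqr_ge0.
Qed.

Lemma sqr_enorm u : enorm u ^+ 2 = dot u u.
Proof. by rewrite sqr_sqrtr// dot_ge0. Qed.

Lemma norm_le_enorm u : `|u| <= enorm u.
Proof.
rewrite [leLHS]/Num.norm/= mx_normrE; apply/bigmax_leP; split; first exact: sqrtr_ge0.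
move=> [i j] _ /=; rewrite ord1 -sqrtr_sqr ler_sqrt ?dot_ge0//.
exact: sqr_coord_le_dot.
Qed.

(** * Compactness, minimizers and nearest points *)

Lemma closed_sqdist_bounded_compact A y (Q : R) :
  closed A -> (forall x, A x -> sqdist x y <= Q) -> compact A.
Proof.
move=> Ac AQ; apply: bounded_closed_compact => //.
exists (`|y| + Num.sqrt Q); split; first exact: num_real.
move=> M yM x Ax /=; rewrite -(subrK y x) (le_trans (ler_normD _ _))//.
rewrite (le_trans _ (ltW yM))// [leLHS]addrC lerD2l.
rewrite (le_trans (norm_le_enorm _))// ler_wsqrtr//; exact: AQ.
Qed.

Lemma closed_enorm_bounded_compact A (r : R) :
  closed A -> (forall x, A x -> enorm x <= r) -> compact A.
Proof.
move=> Ac Ar; apply: (@closed_sqdist_bounded_compact _ 0 (r ^+ 2)) => // x Ax.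
rewrite sqdistx0 -sqr_enorm ler_sqr ?nnegrE ?sqrtr_ge0 ?Ar//.
by rewrite (le_trans _ (Ar _ Ax))// sqrtr_ge0.
Qed.

Lemma compact_argmin (T : topologicalType) (K : set T) (g : T -> R) :
  K !=set0 -> compact K -> continuous g ->
  exists2 c, K c & forall t, K t -> g c <= g t.
Proof.
move=> K0 cK cg; have [|c /set_mem Kc cP] := compact_EVT_min K0 cK (f := g).
  exact: continuous_subspaceT.
by exists c => // t /mem_set; exact: cP.
Qed.

Lemma compact_pos_lbound (T : topologicalType) (K : set T) (g : T -> R) :
  compact K -> continuous g -> (forall t, K t -> 0 < g t) ->
  exists2 c, 0 < c & forall t, K t -> c <= g t.
Proof.
move=> cK cg gpos; have [K0|/set0P/negP/negbNE/eqP->] := pselect (K !=set0); last by exists 1.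
by have [c Kc cP] := compact_argmin K0 cK cg; exists (g c); [exact: gpos|].
Qed.

(** It suffices to minimize over the sublevel set of one point [a] of [A], which is closed by
    continuity and bounded by coercivity. *)
Lemma argmin_nonempty A (h : 'rV[R]_n -> R) :
  closed A -> A !=set0 -> continuous h -> coercive h -> argmin A h !=set0.
Proof.
move=> cA [a Aa] ch coh; have [r rP] := coh (h a + 1).
have hr x : h x <= h a -> enorm x <= r.
  by move=> hx; rewrite leNgt; apply/negP => /ltW/rP; lra.
have cK : compact (A `&` [set x | h x <= h a]).
  apply: (@closed_enorm_bounded_compact _ r); last by move=> x [_]; exact: hr.
  by apply: closedI => //; apply: (@closed_comp _ _ h [set t | t <= h a]) => [x _|];
    [exact: ch|exact: closed_le].
have [|c [Ac ca] cP] := compact_argmin _ cK ch.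
  by exists a; split=> //=; exact: lexx.
exists c; split=> // y Ay; have [ya|/ltW ay] := leP (h y) (h a).
  exact: cP.
exact: le_trans ca ay.
Qed.

Lemma coercive_sqdist y : coercive (fun x => sqdist x y).
Proof.
(* If |x|^2 >= 2|M| + 2|y|^2, then |x|^2 <= 2|x - y|^2 + 2|y|^2 yields M <= |x - y|^2. *)
move=> M; exists (Num.sqrt (2 * `|M| + 2 * dot y y)) => x.
rewrite ler_sqrt ?dot_ge0//.
have := sqdist_triangle x y 0; have := ler_norm M.
by rewrite !sqdistx0; lra.
Qed.

Lemma continuous_sub (T : topologicalType) (g h : T -> 'rV[R]_n) :
  continuous g -> continuous h -> continuous (fun t => g t - h t).
Proof.
by move=> cg ch t; apply: (@continuousB _ 'rV[R]_n T g h); [exact: cg|exact: ch].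
Qed.

Lemma continuous_sqdist y : continuous (fun x => sqdist x y).
Proof.
by apply: continuous_dot; apply: continuous_sub; [by move=> ?; exact: cvg_id|
  exact: cst_continuous|by move=> ?; exact: cvg_id|exact: cst_continuous].
Qed.

Lemma proj_exists A : closed A -> A !=set0 ->
  exists p : 'rV[R]_n -> 'rV[R]_n, forall x, A (p x) /\
    forall y, A y -> sqdist (p x) x <= sqdist y x.
Proof.
move=> cA A0; suff /choice[p pP] : forall x, exists z, argmin A (fun y => sqdist y x) z.
  by exists p.
by move=> x; apply: argmin_nonempty => //;
  [exact: continuous_sqdist|exact: coercive_sqdist].
Qed.

Lemma closed_VI_sol (F : 'rV[R]_n -> 'rV[R]_n) C :
  closed C -> continuous F -> closed (VI_sol F C).
Proof.
move=> cC cF.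
have -> : VI_sol F C = C `&` \bigcap_(y in C) [set x | 0 <= dot (F x) (y - x)].
  by rewrite predeqE.
apply: closedI => //; apply: closed_bigI => y _.
apply: (@closed_comp _ _ (fun x => dot (F x) (y - x)) [set t | 0 <= t]); last exact: closed_ge.
move=> x _; apply: continuous_dot => //.
by apply: continuous_sub; [exact: cst_continuous|by move=> ?; exact: cvg_id].
Qed.

End Dot.

(** * Continuity of finite convex functions *)

Section ConvexContinuity.
Context {R : realType} {n : nat}.
Set Implicit Arguments.
Unset Strict Implicit.
Implicit Types (g : 'rV[R]_n -> R).

(** Convexity with a plain real parameter in place of the interval type of [convex_function]. *)
Definition segment_convex g := forall (t : R) x y, 0 <= t <= 1 ->
  g (t *: x + (1 - t) *: y) <= t * g x + (1 - t) * g y.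

Lemma segment_convex_of_convex_function g :
  convex_function [set: 'rV[R]_n] g -> segment_convex g.
Proof.
move=> cg t x y /andP[t0 t1].
by have := cg (Itv01 t0 t1) x y (in_setT _) (in_setT _).
Qed.

(** Since g(0) = 0, convexity gives g(s w) <= s g(w) for s in [0, 1]; this is used with w = v and w
    = -v, both values being at most [M]. *)
Lemma convex_small_axis g (v : 'rV[R]_n) : segment_convex g -> g 0 = 0 ->
  forall e, 0 < e -> exists2 d, 0 < d & forall s, `|s| <= d -> g (s *: v) <= e.
Proof.
move=> cg g0 e e0; pose M := `|g v| + `|g (- v)| + 1.
have M0 : 0 < M by rewrite ltr_wpDl// addr_ge0.
have gs (s : R) (w : 'rV[R]_n) : 0 <= s <= 1 -> g w <= M -> g (s *: w) <= s * M.
  move=> s01 wM; have := cg s w 0 s01; rewrite scaler0 addr0 g0 mulr0 addr0.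
  by move/le_trans; apply; rewrite ler_wpM2l//; case/andP: s01.
exists (Num.min 1 (e / M)); first by rewrite lt_min ltr01 divr_gt0.
move=> s; rewrite le_min ler_pdivlMr// => /andP[s1 se].
apply: le_trans se; have [s0|s0] := leP 0 s.
  rewrite -{1}(ger0_norm s0); apply: gs; first by rewrite normr_ge0 s1.
  by have := ler_norm (g v); have := normr_ge0 (g (- v)); rewrite /M; lra.
have -> : s *: v = `|s| *: (- v) by rewrite ltr0_norm// scalerN scaleNr opprK.
apply: gs; first by rewrite normr_ge0 s1.
by have := ler_norm (g (- v)); have := normr_ge0 (g v); rewrite /M; lra.
Qed.

Lemma coord_le_norm (h : 'rV[R]_n) i : `|h 0 i| <= `|h|.
Proof.
rewrite [leRHS]/Num.norm/= mx_normrE.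
by apply: (le_bigmax _ (fun ij => `|h ij.1 ij.2|) (0, i)).
Qed.

Lemma convex_small_at0 g : segment_convex g -> g 0 = 0 ->
  forall e, 0 < e -> exists2 d, 0 < d & forall h, `|h| <= d -> g h <= e.
Proof.
move=> cg g0 e e0.
(* Partial sums over a list of coordinates make an induction on the list possible. *)
suff H (r : seq 'I_n) : forall e, 0 < e -> exists2 d, 0 < d & forall h : 'rV[R]_n,
    (forall i, `|h 0 i| <= d) -> g (\sum_(i <- r) h 0 i *: delta_mx 0 i) <= e.
  have [d d0 dP] := H (index_enum _) e e0; exists d => // h hd.
  rewrite (row_sum_delta h); apply: dP => i; apply: le_trans hd.
  exact: coord_le_norm.
(* halving: g (h_j e_j + w) <= g (2 h_j e_j) / 2 + g (2 w) / 2 *)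
elim: r => [|j r IH] {}e {}e0.
  by exists 1 => // h _; rewrite big_nil g0 ltW.
have [d1 d10 d1P] := convex_small_axis (delta_mx 0 j) cg g0 e0.
have [d2 d20 d2P] := IH e e0.
exists (Num.min d1 d2 / 2); first by rewrite divr_gt0// lt_min d10.
move=> h hd; rewrite big_cons.
have half : 0 <= (2^-1 : R) <= 1 by apply/andP; split; lra.
have := cg 2^-1 ((2 * h 0 j) *: delta_mx 0 j)
   (\sum_(i <- r) (2 *: h) 0 i *: delta_mx 0 i) half.
rewrite scalerA mulKf ?pnatr_eq0//.
have -> : (1 - 2^-1 : R) = 2^-1 by lra.
have -> : 2^-1 *: (\sum_(i <- r) (2 *: h) 0 i *: delta_mx 0 i) =
    \sum_(i <- r) h 0 i *: delta_mx 0 i :> 'rV[R]_n.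
  by rewrite scaler_sumr; apply: eq_bigr => i _; rewrite mxE scalerA mulKf ?pnatr_eq0.
have h2 i : `|2 * h 0 i| <= Num.min d1 d2.
  by rewrite normrM ger0_norm// mulrC -ler_pdivlMr.
have := d1P (2 * h 0 j).
have := d2P (2 *: h).
have -> : `|2 * h 0 j| <= d1 by have := h2 j; rewrite le_min => /andP[].
have Hh i : `|(2 *: h) 0 i| <= d2 by have := h2 i; rewrite mxE le_min => /andP[].
move=> /(_ Hh) A /(_ isT) B; lra.
Qed.

Lemma convex_continuous (f : 'rV[R]_n -> R) :
  convex_function [set: 'rV[R]_n] f -> continuous f.
Proof.
move=> /segment_convex_of_convex_function cf a; pose g h := f (a + h) - f a.
have cg : segment_convex g.
  move=> t x y t01; rewrite /g.
  have := cf t (a + x) (a + y) t01.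
  have -> : t *: (a + x) + (1 - t) *: (a + y) = a + (t *: x + (1 - t) *: y).
    by rewrite !scalerDr addrACA -scalerDl subrKC scale1r.
  lra.
have g0 : g 0 = 0 by rewrite /g addr0 subrr.
apply/(@cvgrPdist_le _ _ _ (nbhs a) (nbhs_filter a)) => e e0.
have [d d0 dP] := convex_small_at0 cg g0 e0.
apply/nbhs_ballP; exists d => //= y; rewrite mx_norm_ball /ball_/= => ay.
have h1 : g (y - a) <= e by apply: dP; rewrite distrC ltW.
have h2 : g (- (y - a)) <= e by apply: dP; rewrite normrN distrC ltW.
have half : 0 <= (2^-1 : R) <= 1 by apply/andP; split; lra.
(* The lower bound comes from the upper one by reflection: 0 = g(0) <= (g(h) + g(-h)) / 2 with h = y
   - a, so g(h) >= -g(-h) >= -e. *)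
have := cg 2^-1 (y - a) (- (y - a)) half.
have -> : (1 - 2^-1 : R) = 2^-1 by lra.
rewrite scalerN subrr g0 => h3.
have : g (y - a) = f y - f a by rewrite /g subrKC.
rewrite ler_norml; move=> h4; apply/andP; split; lra.
Qed.
End ConvexContinuity.

(** * One step of the algorithm and the gap of the variational inequality *)

Section Iteration.
Context {R : realType} {n : nat}.
Set Implicit Arguments.
Unset Strict Implicit.
Implicit Types (x y z : 'rV[R]_n) (A C : set 'rV[R]_n).
Implicit Types (F : 'rV[R]_n -> 'rV[R]_n) (f : 'rV[R]_n -> R).

(** Pair the inclusion with z - y, bound the subgradient and normal terms by their definitions, and
    rewrite <y - x, z - y> by the three-point identity; the term -|y - x|^2 is dropped. *)
Lemma step_inequality F C f x y z (l e eta1 eta2 : R) : 0 < l -> 0 <= e ->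
  C z ->
  Minkowski_sum
    (Minkowski_sum [set F y] (scale_set e (subdiff eta1 f y)))
    (normal_set eta2 C y) (- (l^-1 *: (y - x))) ->
  sqdist y z <= sqdist x z - 2 * l * dot (F y) (y - z)
    + 2 * l * e * (f z - f y) + 2 * l * (e * eta1 + eta2).
Proof.
move=> l0 e0 Cz [_ [_ -> [_ [v vf] <-] <-] [w wC] vi].
have l1 : l * dot (- (l^-1 *: (y - x))) (z - y) = - dot (y - x) (z - y).
  by rewrite dotNl dotZl mulrN mulrA divff ?mul1r// gt_eqF.
have := sqdist_three_points x y z.
move: l1; rewrite -vi !dotDl dotZl.
have := vf z; have := wC z Cz; have := sqdist_ge0 y x.
have -> : dot (F y) (z - y) = - dot (F y) (y - z) by rewrite -dotNr opprB.
move=> yx wz /(ler_wpM2l e0) vz eql thr.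
have := ler_wpM2l (ltW l0) wz; have := ler_wpM2l (ltW l0) vz.
lra.
Qed.

Lemma gap_ge0 F C y z : monotone_map F -> VI_sol F C z -> C y ->
  0 <= dot (F y) (y - z).
Proof.
move=> mF [_ zP] Cy; have := zP y Cy; have := mF z y.
by rewrite dotDl dotNl; lra.
Qed.

Lemma gap_gt0 F C y z : monotone_plus F -> VI_sol F C z -> C y ->
  ~ VI_sol F C y -> 0 < dot (F y) (y - z).
Proof.
move=> [mF plusF] Sz Cy nSy; rewrite lt_neqAle (gap_ge0 mF Sz Cy) andbT.
apply/eqP => gap0; apply: nSy; split => // u Cu.
have [Cz zP] := Sz; have := zP y Cy; have := mF z y.
rewrite dotDl dotNl -gap0 => h1 h2.
(* <F z, y - z> is non-negative because z is a solution, and at most <F y, y - z> = 0 by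
   monotonicity. *)
have zy0 : dot (F z) (y - z) = 0 by apply/eqP; rewrite eq_le; apply/andP; split; lra.
have -> : F y = F z by apply: plusF; rewrite dotDl dotNl -gap0 zy0 subr0.
have -> : u - y = (u - z) - (y - z) by rewrite opprB addrA subrK.
by rewrite dotDr dotNr zy0 subr0; exact: zP.
Qed.

(** Stating the distance bound pointwise over [A] exhibits this region as an intersection of closed
    sets. *)
Lemma closed_far A (d : R) : closed [set x | forall z, A z -> d <= sqdist z x].
Proof.
have -> : [set x | forall z, A z -> d <= sqdist z x] =
    \bigcap_(z in A) [set x | d <= sqdist x z].
  by rewrite predeqE => x; split => H z /H; rewrite /= sqdistC.
apply: closed_bigI => z _.
apply: (@closed_comp _ _ (fun x => sqdist x z) [set t | d <= t]); last exact: closed_ge.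
by move=> x _; exact: continuous_sqdist.
Qed.

Lemma closed_sqdist_ball y (Q : R) : closed [set x | sqdist x y <= Q].
Proof.
apply: (@closed_comp _ _ (fun x => sqdist x y) [set t | t <= Q]); last exact: closed_le.
by move=> x _; exact: continuous_sqdist.
Qed.

Lemma compact_sqdist_ball A y (Q : R) :
  closed A -> compact (A `&` [set x | sqdist x y <= Q]).
Proof.
move=> cA; apply: (@closed_sqdist_bounded_compact _ _ _ y Q) => [|x []//].
by apply: closedI => //; exact: closed_sqdist_ball.
Qed.

Lemma sqdist_tail_bound f (z : 'rV[R]_n) : coercive f ->
  exists B : R, forall x, f x < f z -> sqdist x z <= B.
Proof.
move=> /(_ (f z))[r rP]; exists (2 * r ^+ 2 + 2 * dot z z) => x xz.
have xr : enorm x < r by rewrite ltNge; apply/negP => /rP; rewrite leNgt xz.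
have : dot x x <= r ^+ 2.
  rewrite -sqr_enorm ler_sqr ?nnegrE ?sqrtr_ge0//; first exact: ltW.
  exact: le_trans (sqrtr_ge0 _) (ltW xr).
have := sqdist_triangle x 0 z; rewrite (sqdistC 0 z).
by rewrite !sqdistx0; lra.
Qed.

(** * Asymptotics of a sequence obeying the descent inequality *)

Section Convergence.
Context (C : set 'rV[R]_n) (F : 'rV[R]_n -> 'rV[R]_n) (f : 'rV[R]_n -> R).
Context (eps lambda r : nat -> R) (lmin lmax : R) (x : nat -> 'rV[R]_n).
Local Notation S0 := (VI_sol F C).
Local Notation S1 := (argmin S0 f).
Context (C_closed : closed C).
Context (F_continuous : continuous F).
Context (F_monotone_plus : monotone_plus F).
Context (f_continuous : continuous f).
Context (f_coercive : coercive f).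
Context (f_bounded_below : has_lbound (range f)).
Context (S1_nonempty : S1 !=set0).
Context (eps_ge0 : forall k, 0 <= eps k).
Context (eps_cvg0 : eps @ \oo --> (0 : R)).
Context (eps_diverges : forall M, exists N, M <= series eps N).
Context (lmin_gt0 : 0 < lmin).
Context (lambda_bounds : forall k, lmin <= lambda k <= lmax).
Context (r_ge0 : forall k, 0 <= r k).
Context (r_summable : cvgn (series r)).
Context (xC : forall k, C (x k)).
Context (x_step : forall k z, C z ->
  sqdist (x k.+1) z <= sqdist (x k) z
    - 2 * lambda k * dot (F (x k.+1)) (x k.+1 - z)
    + 2 * lambda k * eps k * (f z - f (x k.+1)) + r k).

Let lambda_gt0 k : 0 < lambda k.
Proof. by case/andP: (lambda_bounds k) => + _; apply: lt_le_trans. Qed.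

Lemma x_bounded z : S1 z -> exists Q, forall k, sqdist (x k) z <= Q.
Proof.
move=> [S0z _]; have [B BP] := sqdist_tail_bound z f_coercive.
have ndr := nondecreasing_series_ge0 _ r_ge0.
pose B' := Num.max (sqdist (x 0%N) z) B.
exists (B' + limn (series r)) => k.
apply: (@le_trans _ _ (B' + series r k)); last first.
  by rewrite lerD2l; exact: nondecreasing_cvgn_le.
(* The induction carries the partial sum of [r], so that each step may add its own error. *)
elim: k => [|k IH].
  by rewrite seriesEnat/= big_nil addr0 le_max lexx.
have [lt|ge] := ltP (f (x k.+1)) (f z).
  apply: (@le_trans _ _ B'); first by rewrite le_max BP// orbT.
  by rewrite lerDl seriesEnat/= sumr_ge0.
have := x_step k (proj1 S0z); rewrite seriesS.
have := mulr_ge0 (ltW (lambda_gt0 k)) (gap_ge0 (proj1 F_monotone_plus) S0z (xC k.+1)).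
have := mulr_ge0 (mulr_ge0 (ltW (lambda_gt0 k)) (eps_ge0 k)) (_ : 0 <= f (x k.+1) - f z).
rewrite subr_ge0 => /(_ ge); move: IH; lra.
Qed.

Lemma cvg_to_S0 (p : 'rV[R]_n -> 'rV[R]_n) :
  (forall u, S0 (p u) /\ forall v, S0 v -> sqdist (p u) u <= sqdist v u) ->
  forall d, 0 < d -> \forall k \near \oo, sqdist (p (x k)) (x k) < d.
Proof.
move=> pP d d0; have [zs S1zs] := S1_nonempty; have S0zs := proj1 S1zs.
have [Q QP] := x_bounded S1zs.
(* The point [zs] competes with the projection, so |p(x_k) - x_k|^2 <= Q; the triangle bound then
   gives 2Q + 2Q. *)
have pQ k : sqdist (p (x k)) zs <= 4 * Q.
  have := sqdist_triangle (p (x k)) (x k) zs; have := QP k.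
  have := (pP (x k)).2 _ S0zs; rewrite (sqdistC zs); lra.
have cS0 : closed S0 by exact: closed_VI_sol.
have Q0 : 0 <= Q by exact: le_trans (sqdist_ge0 _ _) (QP 0%N).
(* [K1] holds the iterates still far from the solution set, [K2] the projections of the iterates;
   the gap pairs x_{k+1} with the projection of x_k, hence the product. *)
pose K1 := (C `&` [set u | forall z, S0 z -> d / 2 <= sqdist z u])
  `&` [set u | sqdist u zs <= Q].
pose K2 := S0 `&` [set u | sqdist u zs <= 4 * Q].
have cK1 : compact K1.
  by apply: compact_sqdist_ball; apply: closedI => //; exact: closed_far.
have cK2 : compact K2 by exact: compact_sqdist_ball.
pose gap (t : 'rV[R]_n * 'rV[R]_n) := dot (F t.1) (t.1 - t.2).
have cgap : continuous gap.
  apply: continuous_dot.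
    by move=> t; apply: (@continuous_comp _ _ _ fst F); [exact: cvg_fst|exact: F_continuous].
  by apply: continuous_sub => t; [exact: cvg_fst|exact: cvg_snd].
have [c c0 cP] : exists2 c, 0 < c & forall t, (K1 `*` K2) t -> c <= gap t.
  apply: compact_pos_lbound cgap _; first exact: compact_setX.
  move=> [u z] [/= [[Cu far] _] [S0z _]]; apply: (gap_gt0 F_monotone_plus S0z Cu).
  by move=> /far; rewrite sqdistxx; lra.
(* Minimizing -f gives the maximum of f on [K2]; with the lower bound [fm], [P] bounds f(p(x_k)) -
   f(x_{k+1}) uniformly in k. *)
have [zm [_ _] zmP] : exists2 zm, K2 zm & forall z, K2 z -> - f zm <= - f z.
  apply: compact_argmin cK2 _.
    by exists zs; split => //=; rewrite sqdistxx mulr_ge0.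
  by move=> u; apply: continuousN; exact: f_continuous.
have [fm fmP] := f_bounded_below.
pose P := f zm - fm.
have P0 : 0 <= P by rewrite subr_ge0; apply: fmP; exists zm.
have lmax0 : 0 < lmax.
  by case/andP: (lambda_bounds 0%N) => a b; rewrite (lt_le_trans lmin_gt0)// (le_trans a b).
(* The gap term contributes at least 2 lmin c; the term in [eps] may consume half of it, leaving the
   constant decrease lmin c. *)
have epsP : \forall k \near \oo, 2 * lmax * eps k * P <= lmin * c.
  have e0 : 0 < lmin * c / (2 * lmax * (P + 1)).
    by rewrite divr_gt0 ?mulr_gt0// ltr_wpDl.
  have /cvgrPdist_le /(_ _ e0) := eps_cvg0.
  apply: filterS => k; rewrite sub0r normrN ger0_norm// ler_pdivlMr ?mulr_gt0 ?ltr_wpDl//.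
  have := mulr_ge0 (ltW lmax0) (eps_ge0 k); lra.
have -> : d = 2 * (d / 2) by lra.
apply: (@eventually_lt_of_descent _ _ (fun=> lmin * c) r) => //.
- by rewrite divr_gt0.
- by move=> k; exact: sqdist_ge0.
- by move=> _; rewrite mulr_ge0// ltW.
- have mc0 : 0 < lmin * c by rewrite mulr_gt0.
  move=> M; exists (Num.bound (`|M| / (lmin * c))).
  rewrite seriesEnat/= sumr_const_nat subn0 -mulr_natl -ler_pdivrMr//.
  apply: le_trans (ltW (archi_boundP _)); last by rewrite divr_ge0// ltW.
  by rewrite ler_pM2r ?invr_gt0// ler_norm.
apply: filterS epsP => k epsk dE.
have [S0p pmin] := pP (x k); have [_ pmin'] := pP (x k.+1).
(* The projection of x_k serves as a competitor for that of x_{k+1}. *)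
apply: le_trans (pmin' _ S0p) _.
rewrite sqdistC (sqdistC (p (x k)) (x k)).
apply: le_trans (x_step k (proj1 S0p)) _; rewrite lerD2r.
have gapc : c <= dot (F (x k.+1)) (x k.+1 - p (x k)).
  apply: (cP (x k.+1, p (x k))); split; split => //=.
  split=> // z /pmin'; exact: le_trans.
have fP : f (p (x k)) - f (x k.+1) <= P.
  have := zmP (p (x k)) (conj S0p (pQ k)).
  have := fmP (f (x k.+1)) (imageT _ _); rewrite /P; lra.
have /andP[l1 l2] := lambda_bounds k.
have h1 : lmin * c <= lambda k * dot (F (x k.+1)) (x k.+1 - p (x k)).
  by apply: ler_pM => //; exact: ltW.
have h2 : lambda k * eps k * (f (p (x k)) - f (x k.+1)) <= lmax * eps k * P.
  apply: (@le_trans _ _ (lambda k * eps k * P)).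
    by rewrite ler_wpM2l// mulr_ge0// ltW.
  by rewrite ler_wpM2r// ler_wpM2r.
lra.
Qed.

Lemma cvg_to_S1 (p : 'rV[R]_n -> 'rV[R]_n) :
  (forall u, S1 (p u) /\ forall v, S1 v -> sqdist (p u) u <= sqdist v u) ->
  forall d, 0 < d -> \forall k \near \oo, sqdist (p (x k)) (x k) < d.
Proof.
move=> pP d d0; have [zs S1zs] := S1_nonempty; have S0zs := proj1 S1zs.
have [Q QP] := x_bounded S1zs.
have cS0 : closed S0 by exact: closed_VI_sol.
have [q qP] := proj_exists cS0 (ex_intro _ zs S0zs).
have qQ k : sqdist (q (x k)) zs <= 4 * Q.
  have := sqdist_triangle (q (x k)) (x k) zs; have := QP k.
  have := (qP (x k)).2 _ S0zs; rewrite (sqdistC zs); lra.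
pose K1 := (C `&` [set u | forall z, S1 z -> d / 2 <= sqdist z u])
  `&` [set u | sqdist u zs <= Q].
pose K2 := S0 `&` [set u | sqdist u zs <= 4 * Q].
have cK1 : compact K1.
  by apply: compact_sqdist_ball; apply: closedI => //; exact: closed_far.
have cK2 : compact K2 by exact: compact_sqdist_ball.
(* If both entries of the maximum were non-positive, then u = z would lie in [S0] with f(u) <=
   f(zs), hence in [S1], against its distance from [S1]. So [g] is positive on [K1] times [K2]. *)
pose g := (fun t : 'rV[R]_n * 'rV[R]_n => f t.1 - f zs) \max
  (fun t => dot (t.1 - t.2) (t.1 - t.2)).
have cg : continuous g.
  have cfst : continuous (fst : 'rV[R]_n * 'rV[R]_n -> _) by move=> t; exact: cvg_fst.
  have csnd : continuous (snd : 'rV[R]_n * 'rV[R]_n -> _) by move=> t; exact: cvg_snd.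
  move=> t; apply: continuous_max.
    apply: cvgB; last exact: cvg_cst.
    by apply: (@continuous_comp _ _ _ fst f); [exact: cfst|exact: f_continuous].
  by apply: continuous_dot; apply: continuous_sub.
have [c c0 cP] : exists2 c, 0 < c & forall t, (K1 `*` K2) t -> c <= g t.
  apply: compact_pos_lbound cg _; first exact: compact_setX.
  move=> [u z] [/= [[Cu far] _] [S0z _]]; rewrite /g/=.
  rewrite lt_max subr_gt0; have [//|fu /=] := ltP (f zs) (f u).
  rewrite lt_neqAle dot_ge0 andbT; apply/eqP => uz0.
  have uz : u = z by apply/subr0_eq/dot_eq0.
  have /far : S1 u.
    split; first by rewrite uz.
    by move=> y S0y; apply: le_trans fu _; exact: (proj2 S1zs).
  by rewrite sqdistxx; lra.
have -> : d = 2 * (d / 2) by lra.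
apply: (@eventually_lt_of_descent _ _ (fun k => 2 * lmin * c * eps k) r) => //.
- by rewrite divr_gt0.
- by move=> k; exact: sqdist_ge0.
- by move=> k; rewrite !mulr_ge0// ltW.
- have mc0 : 0 < 2 * lmin * c by rewrite !mulr_gt0.
  move=> M; have [N NP] := eps_diverges (M / (2 * lmin * c)); exists N.
  move: NP; rewrite ler_pdivrMr// !seriesEnat/= => /le_trans; apply.
  by rewrite mulr_suml le_eqVlt; apply/orP; left; apply/eqP; apply: eq_bigr => i _; rewrite mulrC.
have : \forall k \near \oo, sqdist (q (x k.+1)) (x k.+1) < c.
  have [N _ NP] := cvg_to_S0 qP c0.
  by exists N => // k /= Nk; apply: NP => /=; rewrite ltnW.
apply: filterS => k qc dE.
have [S1p pmin] := pP (x k); have [_ pmin'] := pP (x k.+1).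
have S0p := proj1 S1p.
apply: le_trans (pmin' _ S1p) _.
rewrite sqdistC (sqdistC (p (x k)) (x k)).
apply: le_trans (x_step k (proj1 S0p)) _; rewrite lerD2r.
have fpz : f (p (x k)) <= f zs by exact: (proj2 S1p).
(* Here |x_{k+1} - q(x_{k+1})|^2 < c, so the bound c <= g can only come from the entry in f. *)
have fc : c <= f (x k.+1) - f zs.
  have : c <= g (x k.+1, q (x k.+1)).
    apply: cP; split; split => //=; last exact: (qP _).1.
    split=> // z /pmin'; exact: le_trans.
  rewrite le_max => /orP[//|]; rewrite -/(sqdist _ _) sqdistC; lra.
have /andP[l1 l2] := lambda_bounds k.
have h1 := mulr_ge0 (ltW (lambda_gt0 k)) (gap_ge0 (proj1 F_monotone_plus) S0p (xC k.+1)).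
have h2 : lmin * eps k * c <= lambda k * eps k * (f (x k.+1) - f (p (x k))).
  apply: ler_pM; [by rewrite mulr_ge0// ltW|exact: ltW|by rewrite ler_wpM2r|lra].
lra.
Qed.

End Convergence.
End Iteration.

(** * Solution set of the bilevel problem and convergence of the algorithm *)

Theorem theorem4p1 (R : realType) (n : nat) (C : set 'rV[R]_n)
    (F : 'rV[R]_n -> 'rV[R]_n) (f : 'rV[R]_n -> R)
    (C_closed : closed C) (C_convex : convex_set C)
    (F_continuous : continuous F) (F_monotone_plus : monotone_plus F)
    (f_coercive : coercive f)
    (f_convex : convex_function [set: 'rV[R]_n] f)
    (f_bounded_below : has_lbound (range f))
    (S0_nonempty : VI_sol F C !=set0) :
  let S1 := argmin (VI_sol F C) f in
  [/\ S1 !=set0,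
      [bounded enorm x | x in S1] &
      forall (eps lambda eta : nat -> R) (x : nat -> 'rV[R]_n),
        nonincreasing_seq eps ->
        (forall k, 0 <= eps k) ->
        0 < eps 0%N ->
        eps @ \oo --> (0 : R) ->
        (\sum_(0 <= k <oo) (eps k)%:E = +oo)%E ->
        (exists lmin lmax : R, [/\ 0 < lmin, 0 < lmax &
           forall k, lmin <= lambda k <= lmax]) ->
        (forall k, 0 <= eta k) ->
        (\sum_(0 <= k <oo) (eta k)%:E < +oo)%E ->
        generated F C f eps lambda eta x ->
        dist (x k) S1 @[k --> \oo] --> (0 : R)].
Proof.
move=> S1; set S0 := VI_sol F C.
have f_cont := convex_continuous f_convex.
have S0_closed : closed S0 by exact: closed_VI_sol.
have S1_nonempty : S1 !=set0 by exact: argmin_nonempty.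
split => //.
  (* Outside the radius [B] the value of f exceeds the minimum by at least 1, so no minimizer lies
     there. *)
  have [z [S0z zmin]] := S1_nonempty; have [B BP] := f_coercive (f z + 1).
  exists B; split; first exact: num_real.
  move=> M BM y [S0y ymin] /=; rewrite ger0_norm ?sqrtr_ge0//.
  rewrite leNgt; apply/negP => My.
  have := BP y (ltW (lt_trans BM My)); have := ymin z S0z; lra.
move=> eps lambda eta x eps_ni eps0 _ eps_cvg eps_div [lmin [lmax [lmin0 lmax0 lP]]].
move=> eta0 eta_sum [Cx0 gen].
have xC k : C (x k) by case: k => // k; have [] := gen k.
(* Since eps_k <= eps_0 and e1 + e2 <= eta_k, the error eps_k e1 + e2 is at most (eps_0 + 1)
   eta_k. *)
pose r k := 2 * lmax * (eps 0%N + 1) * eta k.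
have c0 : 0 <= 2 * lmax * (eps 0%N + 1).
  by rewrite !mulr_ge0 ?addr_ge0// ltW.
have r0 k : 0 <= r k by rewrite mulr_ge0.
have r_sum : cvgn (series r).
  have := cvgn_series_of_nneseries _ eta0 eta_sum.
  exact: (@is_cvg_seriesZ _ _ (2 * lmax * (eps 0%N + 1))).
have x_step k z : C z -> sqdist (x k.+1) z <= sqdist (x k) z
    - 2 * lambda k * dot (F (x k.+1)) (x k.+1 - z)
    + 2 * lambda k * eps k * (f z - f (x k.+1)) + r k.
  move=> Cz; have [_ [e1 [e2 [e1_0 e2_0 e12 vi]]]] := gen k.
  have /andP[l1 l2] := lP k; have l0 := lt_le_trans lmin0 l1.
  apply: le_trans (step_inequality l0 (eps0 k) Cz vi) _; rewrite lerD2l.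
  have h1 : eps k * e1 + e2 <= (eps 0%N + 1) * eta k.
    have := ler_wpM2r e1_0 (eps_ni _ _ (leq0n k)).
    have := ler_wpM2l (eps0 0%N) e12.
    have := mulr_ge0 (eps0 0%N) e2_0; lra.
  have h0 : 0 <= eps k * e1 + e2 by rewrite addr_ge0// mulr_ge0.
  rewrite /r -!mulrA ler_wpM2l//; exact: ler_pM (ltW l0) h0 l2 h1.
have S1_closed : closed S1.
  have [z [S0z zmin]] := S1_nonempty.
  (* Given one minimizer z, [S1] is a sublevel set of f within [S0], hence closed. *)
  have -> : S1 = S0 `&` [set y | f y <= f z].
    rewrite predeqE => y; split => [[S0y ymin]|[S0y /= yz]]; split=> //.
      exact: ymin.
    by move=> u /zmin; exact: le_trans.
  apply: closedI => //.
  by apply: (@closed_comp _ _ f [set t | t <= f z]) => [y _|];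
    [exact: f_cont|exact: closed_le].
have [p pP] := proj_exists S1_closed S1_nonempty.
have conv := cvg_to_S1 C_closed F_continuous F_monotone_plus f_cont f_coercive
  f_bounded_below S1_nonempty eps0 eps_cvg
  (series_unbounded_of_nneseries _ eps0 eps_div) lmin0 lP r0 r_sum xC x_step pP.
apply/cvgrPdist_lt => e e0.
(* The threshold is e^2 because [conv] concerns squared distances. *)
apply: filterS (conv _ (exprn_gt0 2 e0)) => k pk.
have dist0 : 0 <= dist (x k) S1.
  by apply: lb_le_inf; [exact: image_nonempty|move=> _ [y _ <-]; exact: sqrtr_ge0].
rewrite sub0r normrN ger0_norm//.
apply: (@le_lt_trans _ _ (enorm (p (x k) - x k))).
  apply: ge_inf; last by exists (p (x k)) => //; exact: (pP _).1.
  by exists 0 => _ [y _ <-]; exact: sqrtr_ge0.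
by rewrite -(ltr_pXn2r (ltn0Sn 1)) ?nnegrE ?sqrtr_ge0 ?ltW// sqr_enorm.
Qed.
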